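(* Let $n\ge1$ and let $x=(x_1,\dots,x_{2n})$ be indeterminates. Then \begin{align*} A^{(2)}_{\mathrm{VO}}(8n+1;x;\zeta_4)&=2^{-4n^2+2n}\prod_{i=1}^{2n}x_i^{-4n+2}\prod_{1\le i<j\le2n}(x_j^2+x_i^2)(1+x_i^2x_j^2),\\ A^{(2)}_{\mathrm{VO}}(8n+1;x;\zeta_6)&=\frac{3^{-2n(2n-1)/2}}{\prod_{i=1}^{2n}(x_i+x_i^{-1})}\,\mathrm{Sp}_{4n}\big(\delta(n-1,n-1);x_1^2,\dots,x_{2n}^2\big)\,\tilde{\mathrm O}_{4n}\big(\delta(n+\tfrac12,n-\tfrac12);x_1^2,\dots,x_{2n}^2\big). \end{align*}
   Context: $\sigma(t)=t-t^{-1}$, $\zeta_m=\exp(2\pi\sqrt{-1}/m)$. For parameters $a,c$ let $M^{(2)}_{\mathrm{UO}}(n;x;a,c)$ be the skew-symmetric $2n\times2n$ matrix with entries $\sigma(x_j/x_i)\sigma(x_ix_j)\Big(\dfrac{\sigma(cx_i)\sigma(cx_j)}{\sigma(ax_ix_j)}-\dfrac{\sigma(cx_i)\sigma(c/x_j)}{\sigma(ax_i/x_j)}-\dfrac{\sigma(c/x_i)\sigma(cx_j)}{\sigma(ax_j/x_i)}+\dfrac{\sigma(c/x_i)\sigma(c/x_j)}{\sigma(a/(x_ix_j))}\Big)$, let $F_{\mathrm{UO}}(n;x;a)=\dfrac{\prod_{1\le i<j\le2n}\sigma(ax_i/x_j)\sigma(ax_j/x_i)\sigma(ax_ix_j)\sigma(a/(x_ix_j))}{\prod_{1\le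 i<j\le2n}\sigma(x_j/x_i)\prod_{1\le i\le j\le2n}\sigma(x_ix_j)}$, and $A^{(2)}_{\mathrm{VO}}(8n+1;x;a)=\sigma(a)^{-4n^2+n}F_{\mathrm{UO}}(n;x;a)\operatorname{Pf}M^{(2)}_{\mathrm{UO}}(n;x;a,a)$. Sequences: for $r\in\mathbb Z_{\ge0}$ or $r\in\mathbb Z_{\ge0}+\tfrac12$, $\delta(r)=(r,r-1,\dots)$ consists of all $r-k\ge0$ ($k\in\mathbb Z_{\ge0}$); $\delta(r,s)$ arranges the entries of $\delta(r),\delta(s)$ together in non-increasing order; as the index of a character in $N$ variables it is replaced by its first $N$ entries. With $z_i=x_i^2$ and $z_i^{r}:=x_i^{2r}$ for half-integers $r$: for a partition $\lambda$ of length $\le N$, $\mathrm{Sp}_{2N}(\lambda;z)=\det\big(z_i^{\lambda_j+N-j+1}-z_i^{-(\lambda_j+N-j+1)}\big)/\det\big(z_i^{N-j+1}-z_i^{-(N-j+1)}\big)$; for a half-partition $\lambda=(\lambda_1\ge\dots\ge\lambda_N>0)$, $\lambda_i\in\mathbb Z+\frac12$, $\tilde{\mathrm O}_{2N}(\lambda;z)=\det\big(z_i^{\lambda_j+N-j}+z_i^{-(\lambda_j+N-j)}\big)\big/\big(\tfrac12\det(z_i^{N-j}+z_i^{-(N-j)})\big)$. *)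

(* Defs.v *)
(* MathComp and MathComp-Analysis.  mpoly is imported without its notations,
   which clash with those of MathComp-Analysis. *)
From mathcomp Require Import all_boot all_order all_algebra all_fingroup.
From mathcomp Require Import archimedean fraction complex.
From mathcomp Require Import reals trigo.
From mathcomp Require Import -(notations) mpoly.

Set Implicit Arguments.
Unset Strict Implicit.
Unset Printing Implicit Defensive.

Import Order.TTheory GRing.Theory Num.Theory.
Local Open Scope ring_scope.

(* exp (2 pi sqrt(-1) / m) *)
Definition zeta (R : realType) (m : nat) : R[i] :=
  Complex (cos (2 * pi / m%:R)) (sin (2 * pi / m%:R)).

(* The field R[i](X_0, ..., X_(N-1)) of rational functions in N indeterminates
   with complex coefficients. *)
Definition ratfun (R : realType) (N : nat) : fieldType :=
  {fraction (mpoly N R[i])}.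

Definition indet (R : realType) (N : nat) (i : 'I_N) : ratfun R N :=
  tofrac (mpolyX R[i] (mnm1 i)).

Definition ratfunC (R : realType) (N : nat) (c : R[i]) : ratfun R N :=
  tofrac (mpolyC N c).

Fact ord_even_subproof (n : nat) (i : 'I_n) : (2 * i < 2 * n)%N.
Proof. by rewrite ltn_mul2l /= ltn_ord. Qed.

Fact ord_odd_subproof (n : nat) (i : 'I_n) : ((2 * i).+1 < 2 * n)%N.
Proof. by rewrite mul2n -doubleS -mul2n leq_mul2l /= ltn_ord. Qed.

Definition ord_even (n : nat) (i : 'I_n) : 'I_(2 * n) :=
  Ordinal (ord_even_subproof i).

Definition ord_odd (n : nat) (i : 'I_n) : 'I_(2 * n) :=
  Ordinal (ord_odd_subproof i).

(* This formula is the Pfaffian only when 2 and n! are invertible in F; it is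
   used below in characteristic 0. *)
Definition Pf (F : fieldType) (n : nat) (A : 'M[F]_(2 * n)) : F :=
  ((2 ^ n * n`!)%N%:R)^-1 *
  \sum_(s : 'S_(2 * n))
     (-1) ^+ s * \prod_(i < n) A (s (ord_even i)) (s (ord_odd i)).

Section UOVO.
Variables (F : fieldType) (n : nat).
Implicit Types (x : 'I_(2 * n) -> F) (a c : F).

Definition sigma (t : F) : F := t - t^-1.

Definition M2UO x a c : 'M[F]_(2 * n) :=
  \matrix_(i, j)
    (sigma (x j / x i) * sigma (x i * x j) *
     (  sigma (c * x i) * sigma (c * x j) / sigma (a * x i * x j)
      - sigma (c * x i) * sigma (c / x j) / sigma (a * x i / x j)
      - sigma (c / x i) * sigma (c * x j) / sigma (a * x j / x i)
      + sigma (c / x i) * sigma (c / x j) / sigma (a / (x i * x j)))).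

Definition FUO x a : F :=
  (\prod_(i < 2 * n) \prod_(j < 2 * n | (i < j)%N)
     (sigma (a * x i / x j) * sigma (a * x j / x i) *
      sigma (a * x i * x j) * sigma (a / (x i * x j))))
  / ((\prod_(i < 2 * n) \prod_(j < 2 * n | (i < j)%N) sigma (x j / x i)) *
     (\prod_(i < 2 * n) \prod_(j < 2 * n | (i <= j)%N) sigma (x i * x j))).

(* A_VO^(2)(8n+1; x; a) *)
Definition A2VO x a : F :=
  sigma a ^ (- (4 * n ^ 2)%N%:Z + n%:Z) * FUO x a * Pf (M2UO x a a).

End UOVO.

(* The entries r - k >= 0 with k a natural number, for r >= 0. *)
Definition delta (r : rat) : seq rat :=
  [seq r - k%:R | k <- iota 0 (Num.truncn r).+1].

Definition delta2 (r s : rat) : seq rat :=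
  sort (fun u v : rat => v <= u) (delta r ++ delta s).

Section Characters.
Variables (F : fieldType) (N : nat).
Implicit Types (y : 'I_N -> F) (lambda : seq rat).

(* z ^ r for z = y ^ 2 and r an integer or a half-integer: 2 * r is then an
   integer, equal to its own numerator.  *)
Definition halfpow (y : F) (r : rat) : F := y ^ numq (2 * r).

(* In both characters the variables are z_i = (y_i) ^ 2; they are passed through
   their square roots y_i because half-integer powers of z_i occur.  Columns are
   numbered from 0, so that the shift N - j for j in {1, ..., N} reads
   N - j.+1. *)

(* Sp_{2N}(lambda; y_1 ^ 2, ..., y_N ^ 2), lambda a partition with N entries *)
Definition Sp_char lambda y : F :=
  let e (j : 'I_N) : rat := (N - j.+1)%N%:R + 1 in
  \det (\matrix_(i < N, j < N)
          (halfpow (y i) (lambda`_j + e j) - halfpow (y i) (- (lambda`_j + e j))))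
  / \det (\matrix_(i < N, j < N) (halfpow (y i) (e j) - halfpow (y i) (- e j))).

(* tilde O_{2N}(lambda; y_1 ^ 2, ..., y_N ^ 2), lambda a half-partition with N
   entries *)
Definition tO_char lambda y : F :=
  let e (j : 'I_N) : rat := (N - j.+1)%N%:R in
  \det (\matrix_(i < N, j < N)
          (halfpow (y i) (lambda`_j + e j) + halfpow (y i) (- (lambda`_j + e j))))
  / (2^-1 *
     \det (\matrix_(i < N, j < N) (halfpow (y i) (e j) + halfpow (y i) (- e j)))).

End Characters.

(* Main.v *)
Require Import Defs.
From mathcomp Require Import all_boot all_order all_algebra all_fingroup.
From mathcomp Require Import archimedean fraction complex.
From mathcomp Require Import reals trigo.
From mathcomp Require Import -(notations) mpoly.
From mathcomp Require Import ring lra zify.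

(** Put u_i = x_i^2 + x_i^(-2).  When a = c is zeta_4 or zeta_6, the (i, j)
    entry of the matrix factors as
      - sigma(a) sigma(x_i^2) sigma(x_j^2) (u_j - u_i)(b_j - b_i)/(v_j - v_i)
    with (b, v) = (u, u^2) for zeta_4 and (b, v) = (u^2 - u - 1, u^3 - 3u) for
    zeta_6.  Okada's formula
      Pf ((a_j - a_i)(b_j - b_i)/(v_j - v_i)) =
        det W(v; a) det W(v; b) / prod_(i < j) (v_j - v_i),
    where W(v; a) has rows (1, a_i, v_i, a_i v_i, v_i^2, ...), evaluates the
    Pfaffian.  For zeta_4 the matrices W are Vandermonde matrices in u.  For
    zeta_6 the numerators of the two characters have exponents
    1, 2, 4, 5, ... and 1/2, 5/2, 7/2, 11/2, ..., so that their columns satisfy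
    f_(j+4) = v f_(j+2) - f_j, and unitriangular column operations turn them
    into W(v; u) and W(v; b). *)

Set Implicit Arguments.
Unset Strict Implicit.
Unset Printing Implicit Defensive.

Import Order.TTheory GRing.Theory Num.Theory.
Local Open Scope ring_scope.

(** * Okada's Pfaffian formula *)

(** Both sides have (n + 1)! elements, so injectivity is enough. This splits a sum over permutations
    by the image of 0. *)
Lemma lift_perm_uncurry_bij n :
  bijective (fun p : 'I_n.+1 * 'S_n => lift_perm ord0 p.1 p.2).
Proof.
apply: inj_card_bij => [[i s] [j t] /= est|]; last first.
  by rewrite card_prod card_ord !card_Sn.
have eij : i = j.
  by rewrite -(lift_perm_id ord0 i s) est lift_perm_id.
subst j; congr (_, _); apply/permP=> k; apply: (@lift_inj _ i).
by rewrite -!(lift_perm_lift ord0) est.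
Qed.

Lemma sum_lift_perm (V : nmodType) n (f : 'S_n.+1 -> V) :
  \sum_s f s = \sum_i \sum_(s : 'S_n) f (lift_perm ord0 i s).
Proof. by rewrite (reindex _ (onW_bij _ (lift_perm_uncurry_bij n))) pair_bigA. Qed.

Lemma det_row_perm (R : comPzRingType) n (s : 'S_n) (f : 'I_n -> 'I_n -> R) :
  \det (\matrix_(i, j) f (s i) j) = (-1) ^+ s * \det (\matrix_(i, j) f i j).
Proof.
rewrite -det_perm -det_mulmx -row_permE; congr (\det _).
by apply/matrixP=> i j; rewrite !mxE.
Qed.

Section Triangular.
Variables (R : comPzRingType).

(** The hypothesis says A = B C with C upper triangular of diagonal [k]; the coefficients [c] may
    change with the column. *)
Lemma det_unitriangular_comb N (A B : 'M[R]_N) (k : 'I_N -> R) :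
  (forall j, exists c : 'I_N -> R, forall i,
     A i j = k j * B i j + \sum_(l < N | (l < j)%N) c l * B i l) ->
  \det A = (\prod_j k j) * \det B.
Proof.
case/fin_all_exists=> c cE.
pose C : 'M[R]_N := \matrix_(l, j)
  (if l == j then k j else if (l < j)%N then c j l else 0).
have -> : A = B *m C.
  apply/matrixP=> i j; rewrite cE mxE [RHS](bigD1 j) //= mxE eqxx mulrC; congr (_ + _).
  rewrite [RHS](bigID (fun l : 'I_N => l < j)%N) /= [X in _ + X]big1 ?addr0.
    apply: eq_big => [l|l ltlj]; last by rewrite mxE -val_eqE ltn_eqF // ltlj mulrC.
    by rewrite -val_eqE; case: ltngtP.
  by move=> l /andP[/negPf ne /negPf ge]; rewrite mxE ne ge mulr0.
rewrite det_mulmx mulrC -(det_tr C) det_trig.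
  by congr (_ * _); apply: eq_bigr => j _; rewrite !mxE eqxx.
apply/is_trig_mxP => i j ltij.
by rewrite !mxE -val_eqE gtn_eqF //= ltnNge (ltnW ltij).
Qed.

End Triangular.

Section Pfaffian.
Variable F : fieldType.

(* The columns 1, a, v, av, v^2, a v^2, ...; for u = a and v = u^2 this is the
   Vandermonde matrix of u. *)
Definition Wmx N (v a : 'I_N -> F) : 'M[F]_N :=
  \matrix_(i, j) (a i ^+ odd j * v i ^+ j./2).

Definition Vmx N (v : 'I_N -> F) : 'M[F]_N := \matrix_(i, j) v i ^+ j.

Lemma det_Vmx N (v : 'I_N -> F) :
  \det (Vmx v) = \prod_(i < N) \prod_(j < N | (i < j)%N) (v j - v i).
Proof.
have -> : Vmx v = (Vandermonde N (\row_i v i))^T.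
  by apply/matrixP=> i j; rewrite !mxE.
rewrite det_tr det_Vandermonde.
by apply: eq_bigr => i _; apply: eq_bigr => j _; rewrite !mxE.
Qed.

Lemma Wmx_sqr N (u : 'I_N -> F) : Wmx (fun i => u i ^+ 2) u = Vmx u.
Proof.
apply/matrixP=> i j; rewrite !mxE -exprM -exprD mul2n.
by rewrite odd_double_half.
Qed.

Lemma det_Vmx_neq0 N (v : 'I_N -> F) : injective v -> \det (Vmx v) != 0.
Proof.
move=> injv; rewrite det_Vmx; apply/prodf_neq0 => i _; apply/prodf_neq0 => j ltij.
by rewrite subr_eq0; apply: contraTneq ltij => /injv ->; rewrite ltnn.
Qed.

(** Subtracting v_0 times column j - 2 from column j, for all j >= 2, leaves (v_i - v_0) times the
    old column j - 2. This vanishes in rows 0 and 1, so the matrix becomes block triangular. *)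
Lemma det_Wmx_collapse N (v a : 'I_N.+2 -> F) (i1 := lift ord0 ord0) :
  v ord0 = v i1 ->
  \det (Wmx v a) =
    (a i1 - a ord0) *
    (\prod_(i < N) (v (lift ord0 (lift ord0 i)) - v ord0)) *
    \det (Wmx (fun i : 'I_N => v (lift ord0 (lift ord0 i)))
              (fun i => a (lift ord0 (lift ord0 i)))).
Proof.
move=> ev.
pose B : 'M[F]_(2 + N) := \matrix_(i, j)
  (if (j < 2)%N then a i ^+ j else (v i - v ord0) * (a i ^+ odd j * v i ^+ j.-2./2)).
pose C : 'M[F]_(2 + N) := \matrix_(l, j)
  (if l == j then 1 else if l.+2 == j then - v ord0 else 0).
have -> : \det (Wmx v a) = \det B.
  rewrite -[LHS]mulr1.
  have <- : \det C = 1.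
    rewrite -det_tr det_trig.
      by rewrite big1 // => i _; rewrite !mxE eqxx.
    apply/is_trig_mxP => i j ltij; rewrite !mxE -val_eqE gtn_eqF //.
    by rewrite gtn_eqF // (leq_trans ltij) // ltnW.
  rewrite -det_mulmx; congr (\det _); apply/matrixP=> i j; rewrite !mxE.
  rewrite (bigD1 j) //= !mxE eqxx mulr1.
  have [ltj2|ge2j] := ltnP j 2.
    rewrite big1 ?addr0.
      by case: j ltj2 => [[|[|]]] //= _ _; rewrite ?expr0 ?mulr1 ?mul1r.
    move=> l nelj; rewrite !mxE (negPf nelj) ifF ?mulr0 //.
    by apply/eqP=> e; rewrite -e in ltj2.
  have ltj : (j.-2 < 2 + N)%N by rewrite (leq_ltn_trans _ (ltn_ord j)) // -subn2 leq_subr.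
  have ej : j.-2.+2 = j :> nat by case: (nat_of_ord j) ge2j => [|[|]].
  rewrite (bigD1 (Ordinal ltj)) /=; last by rewrite -val_eqE /= -{2}ej ltn_eqF // ltnW.
  rewrite big1 ?addr0.
    rewrite !mxE -val_eqE /= ej eqxx ltn_eqF; last by rewrite -{2}ej ltnW.
    rewrite -ej /= negbK exprS; ring.
  move=> l /andP[nelj nelj2]; rewrite !mxE (negPf nelj) ifF ?mulr0 //.
  by apply: contraNF nelj2 => /eqP e; rewrite -val_eqE /= -e.
rewrite -(submxK B).
have -> : ursubmx B = 0.
  apply/matrixP=> i j; rewrite !mxE /=.
  suff -> : v (lshift N i) = v ord0 by rewrite subrr mul0r.
  case: i => [[|[|//]]] ?; first by congr v; apply: val_inj.
  by rewrite ev; congr v; apply: val_inj.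
rewrite det_lblock -mulrA; congr (_ * _).
  rewrite (expand_det_row _ ord0) !big_ord_recl big_ord0 /cofactor !det_mx11.
  rewrite !mxE /=.
  have -> : lshift N (ord0 : 'I_2) = (ord0 : 'I_N.+2) by apply: (@ord_inj N.+2).
  have -> : lshift N (lift ord0 0 : 'I_2) = i1 by apply: (@ord_inj N.+2).
  rewrite /bump /= !expr0 !expr1; ring.
have -> : drsubmx B = diag_mx (\row_i (v (lift ord0 (lift ord0 i)) - v ord0)) *m
   Wmx (fun i : 'I_N => v (lift ord0 (lift ord0 i)))
       (fun i => a (lift ord0 (lift ord0 i))).
  apply/matrixP=> i j; rewrite mul_diag_mx !mxE /= negbK.
  have -> : rshift 2 i = lift ord0 (lift ord0 i) by apply: val_inj.
  by [].
rewrite det_mulmx det_diag; congr (_ * _).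
by apply: eq_bigr => i _; rewrite mxE.
Qed.

(** The right-hand side of Okada's formula. *)
Definition Wratio N (v a b : 'I_N -> F) : F :=
  \det (Wmx v a) * \det (Wmx v b) / \det (Vmx v).

Lemma det_Wmx_perm N (s : 'S_N) (v a : 'I_N -> F) :
  \det (Wmx (v \o s) (a \o s)) = (-1) ^+ s * \det (Wmx v a).
Proof. exact: (det_row_perm s (fun i j => a i ^+ odd j * v i ^+ j./2)). Qed.

Lemma det_Vmx_perm N (s : 'S_N) (v : 'I_N -> F) :
  \det (Vmx (v \o s)) = (-1) ^+ s * \det (Vmx v).
Proof. exact: (det_row_perm s (fun i j => v i ^+ j)). Qed.

Lemma Wratio_perm N (s : 'S_N) (v a b : 'I_N -> F) :
  Wratio (v \o s) (a \o s) (b \o s) = (-1) ^+ s * Wratio v a b.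
Proof.
rewrite /Wratio !det_Wmx_perm det_Vmx_perm invfM.
by case: (odd_perm s); rewrite ?expr1 ?expr0 ?invrN1 ?invr1; ring.
Qed.

Lemma eq_Wratio N (v v' a a' b b' : 'I_N -> F) :
  v =1 v' -> a =1 a' -> b =1 b' -> Wratio v a b = Wratio v' a' b'.
Proof.
move=> ev ea eb; rewrite /Wratio.
have -> : Wmx v a = Wmx v' a' by apply/matrixP=> i j; rewrite !mxE ev ea.
have -> : Wmx v b = Wmx v' b' by apply/matrixP=> i j; rewrite !mxE ev eb.
by have -> : Vmx v = Vmx v' by apply/matrixP=> i j; rewrite !mxE ev.
Qed.

(** As polynomials in x, the two sides differ by one of degree below N that vanishes at the N
    distinct nodes. *)
Lemma lagrange_horner N (p : {poly F}) (w : 'I_N -> F) (x : F) :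
  injective w -> (size p <= N)%N ->
  p.[x] = \sum_(q < N) p.[w q] *
            \prod_(k < N | k != q) ((x - w k) / (w q - w k)).
Proof.
move=> injw szp.
pose L (q : 'I_N) : {poly F} := \prod_(k < N | k != q) ((w q - w k)^-1 *: ('X - (w k)%:P)).
have LE q y : (L q).[y] = \prod_(k < N | k != q) ((y - w k) / (w q - w k)).
  rewrite horner_prod; apply: eq_bigr => k _.
  by rewrite hornerZ hornerXsubC mulrC.
have szL q : (size (L q) <= N)%N.
  rewrite /L scaler_prod (leq_trans (size_scale_leq _ _)) //.
  rewrite -big_filter size_prod_XsubC size_filter -sum1_count.
  rewrite (sum1_card (predC1 q)) cardC1 card_ord prednK //.
  exact: leq_ltn_trans (ltn_ord q).
suff pE : p = \sum_(q < N) p.[w q] *: L q.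
  rewrite {1}pE horner_sum; apply: eq_bigr => q _.
  by rewrite hornerZ LE.
apply/eqP; rewrite -subr_eq0; apply/eqP.
apply: (@roots_geq_poly_eq0 _ _ (map w (enum 'I_N))).
- apply/allP => _ /mapP[q _ ->]; rewrite rootE !hornerE horner_sum subr_eq0.
  rewrite (bigD1 q) //= hornerZ LE big1.
    rewrite mulr1 big1 ?addr0 // => k nekq.
    by rewrite hornerZ LE (bigD1 q) 1?eq_sym //= subrr mul0r mul0r mulr0.
  move=> k nekq; rewrite divff // subr_eq0.
  by apply: contraNneq nekq => /injw ->.
- by rewrite map_inj_uniq ?enum_uniq.
rewrite size_map size_enum_ord (leq_trans (size_polyD _ _)) // geq_max szp size_polyN /=.
apply: (leq_trans (size_sum _ _ _)); apply/bigmax_leqP => q _.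
exact: leq_trans (size_scale_leq _ _) (szL q).
Qed.

Lemma prod_lift N (q : 'I_N.+1) (f : 'I_N.+1 -> F) :
  \prod_(k < N.+1 | k != q) f k = \prod_(k < N) f (lift q k).
Proof.
rewrite big_mkcond (bigD1_ord q) //= eqxx mul1r; apply: eq_bigr => k _.
by rewrite eq_sym neq_lift.
Qed.

Lemma det_Vmx_recl N (v : 'I_N.+1 -> F) :
  \det (Vmx v) =
    (\prod_(k < N) (v (lift ord0 k) - v ord0)) * \det (Vmx (fun k => v (lift ord0 k))).
Proof.
rewrite !det_Vmx big_ord_recl; congr (_ * _).
  by rewrite big_mkcond big_ord_recl /= mul1r.
apply: eq_bigr => i _; rewrite big_mkcond big_ord_recl /= mul1r -big_mkcond /=.
by apply: eq_bigl => j; rewrite /bump !leq0n.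
Qed.

(* The expansion of the right-hand side of Okada's formula along its first
   row: as a function of v_0 the numerator is a polynomial of degree at most
   2n - 2, hence given by Lagrange interpolation at the 2n - 1 other nodes, and
   at each node both determinants collapse. *)
Lemma Wratio_expand0 n (v a b : 'I_n.*2.+2 -> F) : injective v ->
  \sum_(q < n.*2.+1)
     (-1) ^+ q *
     ((a (lift ord0 q) - a ord0) * (b (lift ord0 q) - b ord0)
       / (v (lift ord0 q) - v ord0)) *
     Wratio (fun k => v (lift ord0 (lift q k))) (fun k => a (lift ord0 (lift q k)))
            (fun k => b (lift ord0 (lift q k)))
  = Wratio v a b.
Proof.
move=> injv.
pose w (q : 'I_n.*2.+1) := v (lift ord0 q).
have injw : injective w by move=> q r /injv /lift_inj.
(* [vat x] replaces v_0 by x; [Q c] replaces it by the polynomial variable and keeps c_0. Row 0 of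
   [Q c] contains only powers X^k with k <= n. *)
pose vat x i := if i == ord0 then x else v i.
pose Q (c : 'I_n.*2.+2 -> F) : 'M[{poly F}]_n.*2.+2 := \matrix_(i, j)
   if i == ord0 then (c i ^+ odd j) *: 'X^(j./2) else (c i ^+ odd j * v i ^+ j./2)%:P.
have QE c x : (\det (Q c)).[x] = \det (Wmx (vat x) c).
  rewrite -[LHS]/(horner_eval x _) -det_map_mx; congr (\det _); apply/matrixP=> i j.
  rewrite !mxE /horner_eval /vat; case: eqVneq => _ /=; rewrite ?/(horner_eval _ _); last by rewrite hornerC.
  by rewrite hornerZ hornerXn.
have szQ c : (size (\det (Q c)) <= n.+1)%N.
  rewrite (expand_det_row _ ord0) (leq_trans (size_sum _ _ _)) //.
  apply/bigmax_leqP => j _; rewrite !mxE eqxx.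
  have -> : cofactor (Q c) ord0 j = (cofactor (Wmx v c) ord0 j)%:P.
    rewrite /cofactor rmorphM rmorph_sign -det_map_mx; congr (_ * \det _).
    by apply/matrixP=> i k; rewrite !mxE.
  rewrite mulrC mul_polyC !(leq_trans (size_scale_leq _ _)) // size_polyXn.
  by rewrite ltnS leq_half_double -ltnS.
pose rest (c : 'I_n.*2.+2 -> F) (q : 'I_n.*2.+1) (k : 'I_n.*2) := c (lift ord0 (lift q k)).
(* [s q] brings the row of the node [w q] to position 1 and keeps the other rows in order, so that
   [det_Wmx_collapse] applies at this node. *)
pose s q : 'S_n.*2.+2 := lift_perm ord0 ord0 (lift_perm ord0 q 1%g).
have sgn_s q : (-1) ^+ s q = (-1) ^+ q :> F.
  by rewrite -[RHS]signr_odd !odd_lift_perm odd_perm1 addbF.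
have s0 q : s q ord0 = ord0 by rewrite lift_perm_id.
have s1 q : s q (lift ord0 ord0) = lift ord0 q by rewrite lift_perm_lift lift_perm_id.
have s2 q k : s q (lift ord0 (lift ord0 k)) = lift ord0 (lift q k).
  by rewrite !lift_perm_lift perm1.
have nodeQ c q : (\det (Q c)).[w q] = (-1) ^+ q * ((c (lift ord0 q) - c ord0) *
   (\prod_(k < n.*2) (w (lift q k) - w q)) * \det (Wmx (rest v q) (rest c q))).
  rewrite QE -[LHS](signrMK (s q)) -det_Wmx_perm sgn_s; congr (_ * _).
  rewrite det_Wmx_collapse /= ?s0 ?s1 ?/vat //. congr (_ * _); [congr (_ * _)|congr (\det _)].
    by apply: eq_bigr => k _; rewrite s2.
  by apply/matrixP=> i j; rewrite !mxE /= s2.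
have VE (q : 'I_n.*2.+1) : \det (Vmx v) = (-1) ^+ q * ((w q - v ord0) *
   (\prod_(k < n.*2) ((w (lift q k) - v ord0) * (w (lift q k) - w q))) *
   \det (Vmx (rest v q))).
  rewrite -[LHS](signrMK (s q)) -det_Vmx_perm sgn_s; congr (_ * _).
  rewrite det_Vmx_recl big_ord_recl [X in _ * X]det_Vmx_recl /= s0 s1 !mulrA.
  congr (_ * _); last by congr (\det _); apply/matrixP=> i j; rewrite !mxE s2.
  rewrite big_split mulrA /=; congr (_ * _ * _).
    by apply: eq_bigr => k _; rewrite s2.
  by apply: eq_bigr => k _; rewrite s2.
have repv : vat (v ord0) =1 v by move=> i; rewrite /vat; case: eqVneq => [->|].
have eqW c : Wmx v c = Wmx (vat (v ord0)) c.
  by apply/matrixP=> i j; rewrite !mxE repv.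
(* The product of the two polynomial determinants has size at most 2n + 1, the number of nodes. *)
rewrite {2}/Wratio !eqW -!QE -hornerM (lagrange_horner (w := w)) //; last first.
  rewrite (leq_trans (size_polyMleq _ _)) //.
  rewrite -ltnS; case: (_ + _)%N (leq_add (szQ a) (szQ b)) => [|m]; first by [].
  by rewrite addSn addnS -addnn.
rewrite mulr_suml; apply: eq_bigr => q _.
rewrite hornerM !nodeQ {1}/Wratio (VE q) -/(rest v q) -/(rest a q) -/(rest b q).
rewrite prod_lift.
have -> : \prod_(k < n.*2) ((v ord0 - w (lift q k)) / (w q - w (lift q k))) =
    (\prod_(k < n.*2) (w (lift q k) - v ord0)) / \prod_(k < n.*2) (w (lift q k) - w q).
  rewrite -prodf_div; apply: eq_bigr => k _.
  by rewrite -opprB -[w q - _]opprB invrN mulrNN.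
have nz1 : w q - v ord0 != 0 by rewrite subr_eq0 (inj_eq injv) eq_sym neq_lift.
have nz2 : \prod_(k < n.*2) (w (lift q k) - v ord0) != 0.
  by apply/prodf_neq0 => k _; rewrite subr_eq0 (inj_eq injv) eq_sym neq_lift.
have nz3 : \prod_(k < n.*2) (w (lift q k) - w q) != 0.
  by apply/prodf_neq0 => k _; rewrite subr_eq0 (inj_eq injw) eq_sym neq_lift.
have nz4 : \det (Vmx (rest v q)) != 0.
  by apply: det_Vmx_neq0 => k l /injv /lift_inj /lift_inj.
rewrite big_split /= -signr_odd -/(w q).
case: (odd q); rewrite ?expr1 ?expr0; field;
  by rewrite ?nz1 ?nz2 ?nz3 ?nz4 ?oppr_eq0 ?oner_eq0.
Qed.


(** A cycle of sign (-1)^p moves row p to the front, and the antisymmetry of [Wratio] reduces the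
    claim to row 0. *)
Lemma Wratio_expand n (v a b : 'I_n.*2.+2 -> F) (p : 'I_n.*2.+2) : injective v ->
  \sum_(q < n.*2.+1)
     (-1) ^+ p * (-1) ^+ q *
     ((a (lift p q) - a p) * (b (lift p q) - b p) / (v (lift p q) - v p)) *
     Wratio (fun k => v (lift p (lift q k))) (fun k => a (lift p (lift q k)))
            (fun k => b (lift p (lift q k)))
  = Wratio v a b.
Proof.
move=> injv; pose s : 'S_n.*2.+2 := lift_perm ord0 p 1%g.
have sgn_s : (-1) ^+ s = (-1) ^+ p :> F.
  by rewrite -[RHS]signr_odd odd_lift_perm odd_perm1 addbF.
have s0 : s ord0 = p by rewrite lift_perm_id.
have s1 q : s (lift ord0 q) = lift p q by rewrite lift_perm_lift perm1.
have injvs : injective (v \o s) by apply: inj_comp => //; apply: perm_inj.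
rewrite -[RHS](signrMK s) -Wratio_perm -(Wratio_expand0 _ _ injvs) sgn_s.
rewrite mulr_sumr; apply: eq_bigr => q _; rewrite /= !s1 !s0 [RHS]mulrA.
congr (_ * _); first by rewrite mulrA.
by apply: eq_Wratio => k /=; rewrite s1.
Qed.

(** Fixing the images p of 0 and [lift p q] of 1 leaves the same sum over a smaller symmetric group,
    and [Wratio_expand] resums over q. The equation [e] and the functions [f], [g] let the index
    size be [2 * n] as well as [n.*2]. *)
Lemma sum_pairing_Wratio n N (e : N = n.*2) (v a b : 'I_N -> F)
    (f g : 'I_n -> 'I_N) :
  injective v -> (forall i, f i = i.*2 :> nat) -> (forall i, g i = i.*2.+1 :> nat) ->
  \sum_(s : 'S_N) (-1) ^+ s *
     \prod_(i < n) ((a (s (g i)) - a (s (f i))) * (b (s (g i)) - b (s (f i)))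
                    / (v (s (g i)) - v (s (f i))))
  = (2 ^ n * n`!)%N%:R * Wratio v a b.
Proof.
subst N; elim: n => [|n IHn] in v a b f g * => injv fE gE.
  rewrite (eq_bigr (fun=> 1)) => [|s _]; last first.
    by rewrite big_ord0 mulr1 (_ : s = 1%g) ?odd_perm1 //; apply/permP => -[].
  by rewrite sumr_const card_Sn /Wratio !det_mx00 divr1 !mulr1.
rewrite sum_lift_perm.
have step (p : 'I_n.*2.+2) :
  \sum_(s : 'S_n.*2.+1) (-1) ^+ lift_perm ord0 p s *
     \prod_(i < n.+1) ((a (lift_perm ord0 p s (g i)) - a (lift_perm ord0 p s (f i))) *
          (b (lift_perm ord0 p s (g i)) - b (lift_perm ord0 p s (f i)))
          / (v (lift_perm ord0 p s (g i)) - v (lift_perm ord0 p s (f i))))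
  = (2 ^ n * n`!)%N%:R * Wratio v a b.
  rewrite -(Wratio_expand a b p injv) sum_lift_perm mulr_sumr.
  apply: eq_bigr => q _.
  have f0 : f ord0 = ord0 by apply: ord_inj; rewrite fE.
  have g0 : g ord0 = lift ord0 ord0 by apply: ord_inj; rewrite gE.
  have ltf (i : 'I_n) : (i.*2 < n.*2)%N by rewrite ltn_double.
  have ltg (i : 'I_n) : (i.*2.+1 < n.*2)%N by rewrite -doubleS leq_double.
  have fS i : f (lift ord0 i) = lift ord0 (lift ord0 (Ordinal (ltf i))).
    by apply: ord_inj; rewrite fE.
  have gS i : g (lift ord0 i) = lift ord0 (lift ord0 (Ordinal (ltg i))).
    by apply: ord_inj; rewrite gE.
  have injr : injective (fun k => v (lift p (lift q k))).
    by move=> k l /injv /lift_inj /lift_inj.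
  have IH := IHn _ (fun k => a (lift p (lift q k))) (fun k => b (lift p (lift q k)))
    (fun i => Ordinal (ltf i)) (fun i => Ordinal (ltg i)) injr
    (fun=> erefl) (fun=> erefl).
  rewrite [RHS]mulrCA -IH mulr_sumr; apply: eq_bigr => s _.
  have -> : (-1) ^+ lift_perm ord0 p (lift_perm ord0 q s) =
            (-1) ^+ p * (-1) ^+ q * (-1) ^+ s :> F.
    by rewrite !odd_lift_perm !signr_addb expr0 !mul1r !signr_odd mulrA.
  rewrite big_ord_recl f0 g0 !lift_perm_lift !lift_perm_id [RHS]mulrACA.
  congr (_ * (_ * _)).
  by apply: eq_bigr => i _; rewrite fS gS !lift_perm_lift.
(* Each of the 2(n + 1) values of p contributes the same amount, which turns 2^n n! into 2^(n+1)
   (n+1)!. *)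
rewrite (eq_bigr _ (fun p _ => step p)) sumr_const card_ord -mulrnAl -mulrnA.
by congr (_%:R * _); rewrite expnS factS -mul2n; ring.
Qed.

End Pfaffian.

(** * The symplectic and orthogonal characters *)

(** Merging two equal sequences doubles every entry, so the j-th entry of delta(n, n) lies
    floor(j/2) below the top. *)
Lemma perm_iota_half n : perm_eq (iota 0 n ++ iota 0 n) (map half (iota 0 n.*2)).
Proof.
elim: n => // n IHn.
have -> : iota 0 n.+1 = rcons (iota 0 n) n by rewrite -cats1 -addn1 iotaD.
have -> : iota 0 n.+1.*2 = rcons (rcons (iota 0 n.*2) n.*2) n.*2.+1.
  by rewrite -!cats1 -catA doubleS -addn2 iotaD.
have /seq.permP cnt := IHn; apply/seq.permP => p; move: (cnt p).
rewrite !map_rcons -!cats1 !count_cat /= doubleK uphalf_double; lia.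
Qed.

(** If the second sequence starts one step lower, the top entry is single and the others are paired,
    whence ceil(j/2). *)
Lemma perm_iota_uphalf n :
  perm_eq (iota 0 n.+1 ++ iota 1 n) (map uphalf (iota 0 n.*2.+1)).
Proof.
have e1 k : iota 1 k = map S (iota 0 k) by rewrite -(iotaDl 1).
rewrite /= perm_cons !e1 -map_cat -map_comp.
by rewrite (perm_trans (perm_map S (perm_iota_half n))) // -map_comp perm_refl.
Qed.

(** A sorted sequence is determined by its multiset of entries; [p] gives the distance of the j-th
    entry below t. *)
Lemma delta2_of_perm (r s t : rat) (p : nat -> nat) m :
  {homo p : i j / (i <= j)%N} ->
  perm_eq (delta r ++ delta s) (map (fun k : nat => t - k%:R) (map p (iota 0 m))) ->
  forall j, (j < m)%N -> (delta2 r s)`_j = t - (p j)%:R.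
Proof.
move=> homop perm_rs j ltjm.
pose f k : rat := t - (p k)%:R.
have -> : delta2 r s = map f (iota 0 m).
  apply: (@sorted_eq _ (fun u v : rat => v <= u)).
  - by move=> x y z yx zx; apply: le_trans zx yx.
  - by move=> x y; rewrite andbC => /le_anti.
  - by apply: sort_sorted => x y; apply: le_total.
  - apply: (homo_sorted (e := leq)) (iota_sorted 0 m) => x y lexy.
    by rewrite lerD2l lerN2 ler_nat homop.
  - by rewrite perm_sort (perm_trans perm_rs) // -map_comp.
by rewrite (nth_map 0%N) ?size_iota // nth_iota.
Qed.

Lemma nth_delta2_pred n j : (j < n.+1.*2)%N ->
  (delta2 (n.+1%:R - 1) (n.+1%:R - 1))`_j = n%:R - (j./2)%:R.
Proof.
have -> : (n.+1%:R - 1 : rat) = n%:R by rewrite -natr1 addrK.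
move: j; apply: delta2_of_perm; first exact: half_leq.
have tn : Num.truncn (n%:R : rat) = n by apply: truncn_def; rewrite lexx ltr_nat /=.
by rewrite /delta tn -map_cat perm_map // perm_iota_half.
Qed.

Lemma nth_delta2_half n j : (j < n.+1.*2.+1)%N ->
  (delta2 (n.+1%:R + 1 / 2) (n.+1%:R - 1 / 2))`_j = n.+1%:R + 1 / 2 - (uphalf j)%:R.
Proof.
move: j; apply: delta2_of_perm; first exact: uphalf_leq.
apply: (perm_trans _ (perm_map _ (perm_iota_uphalf n.+1))).
rewrite map_cat /delta.
(* The two sequences have n + 2 and n + 1 entries, one more in all than the 2(n + 1) variables;
   [take] removes the last one in the character. *)
have -> : Num.truncn (n.+1%:R + 1 / 2 : rat) = n.+1.
  by apply: truncn_def; rewrite -[n.+2%:R]natr1; apply/andP; split; lra.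
have -> : Num.truncn (n.+1%:R - 1 / 2 : rat) = n.
  by apply: truncn_def; rewrite -natr1; apply/andP; split; lra.
rewrite perm_cat2l (iotaDl 1 0) -map_comp.
rewrite [X in perm_eq _ X](eq_map (g := fun k : nat => n.+1%:R - 1 / 2 - k%:R)) // => k /=.
by rewrite natrD -natr1; lra.
Qed.

(** * Determinants whose columns satisfy a two-step recurrence *)

Section Determinants.
Variable F : fieldType.

Section Recurrence.
Variables (N : nat) (v a d : 'I_N -> F).

Let g l i := d i * (a i ^+ odd l * v i ^+ l./2).
(** Membership in the span of the first m columns of diag(d) W(v; a), with coefficients independent
    of the row. *)
Let low m (h : 'I_N -> F) := exists c : nat -> F, forall i, h i = \sum_(l < m) c l * g l i.

Let lowD m h k : low m h -> low m k -> low m (fun i => h i + k i).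
Proof.
move=> [c cE] [e eE]; exists (fun l => c l + e l) => i.
by rewrite cE eE -big_split; apply: eq_bigr => l _; rewrite mulrDl.
Qed.

Let lowZ m x h : low m h -> low m (fun i => x * h i).
Proof.
move=> [c cE]; exists (fun l => x * c l) => i.
by rewrite cE mulr_sumr; apply: eq_bigr => l _; rewrite mulrA.
Qed.

Let low_gen m l : (l < m)%N -> low m (g l).
Proof.
move=> ltlm; exists (fun k => (k == l)%:R) => i.
rewrite (bigD1 (Ordinal ltlm)) //= eqxx mul1r big1 ?addr0 // => k.
by rewrite -val_eqE /= => /negPf ->; rewrite mul0r.
Qed.

Let low_widen m p h : (m <= p)%N -> low m h -> low p h.
Proof.
move=> lemp [c cE]; exists (fun l => if (l < m)%N then c l else 0) => i.
rewrite cE (big_ord_widen p (fun l => c l * g l i)) // big_mkcond.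
by apply: eq_bigr => l _; case: ifP; rewrite ?mul0r.
Qed.

(** Multiplication by v sends column l of diag(d) W(v; a) to column l + 2. *)
Let low_mulv m h : low m h -> low m.+2 (fun i => v i * h i).
Proof.
move=> [c cE]; exists (fun l => if l is l'.+2 then c l' else 0) => i.
rewrite cE !big_ord_recl !mul0r !add0r mulr_sumr; apply: eq_bigr => l _.
rewrite /= /g /= negbK exprS; ring.
Qed.

(** Since v g_j = g_(j+2), strong induction shows that f_j - g_j lies in the span of the columns g_l
    with l < j. The passage from g to f is thus unitriangular. *)
Lemma det_recurrence (f : nat -> 'I_N -> F) :
  f 0%N =1 d -> f 1%N =1 (fun i => d i * a i) ->
  (forall j, exists x y k l, [/\ (k < j.+2)%N, (l < j.+2)%N &
     forall i, f j.+2 i = v i * f j i + x * f k i + y * f l i]) ->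
  \det (\matrix_(i, j) f j i) = (\prod_i d i) * \det (Wmx v a).
Proof.
move=> f0 f1 frec.
have low_eq m h k : h =1 k -> low m h -> low m k.
  by move=> ehk [c cE]; exists c => i; rewrite -ehk.
have lowf j : low j (fun i => f j i - g j i).
  elim/ltn_ind: j => -[|[|j]] IH.
  - by exists (fun=> 0) => i; rewrite big_ord0 f0 /g !mulr1 subrr.
  - by exists (fun=> 0) => i; rewrite big1 ?f1 /g ?mulr1 ?subrr // => l; rewrite mul0r.
  have [x [y [k [l [ltk ltl fE]]]]] := frec j.
  have lowfk m : (m < j.+2)%N -> low j.+2 (f m).
    move=> ltm; apply: (low_eq _ (fun i => (f m i - g m i) + g m i)).
      by move=> i; rewrite subrK.
    by apply: lowD; [apply: low_widen (IH m ltm); apply: ltnW | apply: low_gen].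
  apply: (low_eq _ (fun i => v i * (f j i - g j i) + (x * f k i + y * f l i))).
    by move=> i; rewrite fE /g /= negbK exprS; ring.
  apply: lowD; first by apply/low_mulv/IH.
  by apply: lowD; apply/lowZ/lowfk.
rewrite (@det_unitriangular_comb _ _ _ (\matrix_(i, j) g j i) (fun=> 1)).
  rewrite big1 // mul1r.
  have -> : \matrix_(i, j) g j i = diag_mx (\row_i d i) *m Wmx v a.
    by apply/matrixP=> i j; rewrite mul_diag_mx !mxE.
  by rewrite det_mulmx det_diag; congr (_ * _); apply: eq_bigr => i _; rewrite mxE.
move=> j; have [c cE] := lowf j; exists (fun l => c l) => i.
rewrite !mxE mul1r; apply/eqP; rewrite addrC -subr_eq; apply/eqP; rewrite cE.
rewrite (big_ord_widen N (fun l => c l * g l i)) 1?ltnW //.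
by apply: eq_bigr => l _; rewrite mxE.
Qed.

End Recurrence.

End Determinants.

(** * Numerators and denominators of the two characters *)

Section Characters.
Variable F : fieldType.

(** The sign s is 1 for orthogonal and -1 for symplectic columns. With y = x_i, [expsum 1 y 2] is
    u_i and [expsum 1 y 6] is u_i^3 - 3 u_i. *)
Definition expsum (s y : F) (p : nat) : F := y ^+ p + s * y ^- p.

Lemma expsum_rec s y m p : y != 0 ->
  expsum s y (p + m + m) = expsum 1 y m * expsum s y (p + m) + -1 * expsum s y p.
Proof. by move=> y0; rewrite /expsum !exprD; field; rewrite ?y0 ?expf_neq0. Qed.

Lemma halfpow_nat (y : F) (r : rat) (m : nat) :
  2 * r = m%:R -> halfpow y r = y ^+ m.
Proof. by move=> e; rewrite /halfpow e -[m%:R]/(m%:~R) numq_int. Qed.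

Lemma halfpow_natN (y : F) (r : rat) (m : nat) :
  2 * r = m%:R -> halfpow y (- r) = y ^- m.
Proof.
by move=> e; rewrite /halfpow mulrN e -[m%:R]/(m%:~R) -mulrNz numq_int -exprnN.
Qed.

(** As j + k = 2n + 1 is odd, floor(j/2) + floor(k/2) = n. Read from the last column, the exponents
    of z are 1, 2, 4, 5, ... *)
Lemma Sp_exponent n j k : (j + k).+1 = (2 * n.+1)%N ->
  2 * (n%:R - j./2%:R + (k%:R + 1)) = (2 * (1 + k + k./2))%:R :> rat.
Proof.
move=> e; have -> : (n = j./2 + k./2)%N by lia.
by rewrite natrM !natrD; ring.
Qed.

(** Here ceil(j/2) + ceil(k/2) = n + 1, and from the last column the exponents of z are 1/2, 5/2,
    7/2, 11/2, ... *)
Lemma tO_exponent n j k : (j + k).+1 = (2 * n.+1)%N ->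
  2 * (n.+1%:R + 1 / 2 - (uphalf j)%:R + k%:R) = (1 + 2 * k + 2 * uphalf k)%:R :> rat.
Proof.
move=> e; have -> : (n.+1 = uphalf j + uphalf k)%N by lia.
by rewrite (natrD _ (1 + 2 * k)) (natrD _ 1) !natrM natrD; lra.
Qed.

Lemma rev_ordK_nat N (j : 'I_N) : (j + rev_ord j).+1 = N.
Proof. by rewrite -addSn subnKC. Qed.

(** Reversing the columns makes the exponents increase with the index; the sign cancels in the
    quotient defining a character. *)
Lemma det_rev_col N (f : 'I_N -> 'I_N -> F) :
  \det (\matrix_(i, j) f i (rev_ord j)) =
    (-1) ^+ perm (@rev_ord_inj N) * \det (\matrix_(i, j) f i j).
Proof.
have := det_row_perm (perm (@rev_ord_inj N)) (fun j i => f i j).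
rewrite -det_tr -[X in _ = _ * X]det_tr.
have -> : (\matrix_(i, j) f j i)^T = \matrix_(i, j) f i j.
  by apply/matrixP=> i j; rewrite !mxE.
move=> <-; congr (\det _).
by apply/matrixP=> i j; rewrite !mxE permE.
Qed.

Lemma signed_divff N (s : 'S_N) (p q : F) : ((-1) ^+ s * p) / ((-1) ^+ s * q) = p / q.
Proof. by rewrite invfM mulrACA divff ?mul1r // signr_eq0. Qed.

(** The symplectic denominator. From u^2 f_j = f_(j+2) + 2 f_j + f_(j-2), the recurrence holds with
    v = u^2 and a = u, for which W is the Vandermonde matrix of u. *)
Lemma det_expsum2 N (y : 'I_N -> F) : (forall i, y i != 0) ->
  \det (\matrix_(i, j) expsum (-1) (y i) (2 * j.+1)) =
  (\prod_i expsum (-1) (y i) 2) * \det (Vmx (fun i => expsum 1 (y i) 2)).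
Proof.
move=> y0; rewrite -Wmx_sqr -(@det_recurrence _ _ _ _ _ (fun j i => expsum (-1) (y i) (2 * j.+1))) //.
  by move=> i; rewrite /expsum; field; rewrite y0.
(* The first two cases use f_(-2) = -f_0 and f_(-1) = 0. *)
move=> [|[|j]].
- exists (- 1), 0, 0%N, 0%N; split=> // i.
  by rewrite /expsum; field; rewrite y0.
- exists (- 2), 0, 1%N, 0%N; split=> // i.
  by rewrite /expsum; field; rewrite y0.
exists (- 2), (- 1), j.+2, j; split=> [||i]; [lia|lia|].
have -> : (2 * j.+4.+1 = 2 * j.+1 + 4 + 4)%N by lia.
rewrite expsum_rec // (_ : (2 * j.+1 + 4 = 2 * j.+3)%N); last by lia.
by rewrite /expsum; field; rewrite y0 ?expf_neq0.
Qed.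

(** The orthogonal denominator. Its column 0 is constantly 2; it is replaced by 1, and the factor 2
    taken out cancels the 1/2 in [tO_char]. *)
Lemma det_expsum2_even N (y : 'I_N.+1 -> F) : (forall i, y i != 0) ->
  \det (\matrix_(i, j) expsum 1 (y i) (2 * j)) =
  2 * \det (Vmx (fun i => expsum 1 (y i) 2)).
Proof.
move=> y0; pose f j i := if j is 0%N then 1 else expsum 1 (y i) (2 * j).
rewrite (@det_unitriangular_comb _ _ _ (\matrix_(i, j) f j i) (fun j => if j == ord0 then 2 else 1)).
  rewrite (bigD1 ord0) //= big1 ?mulr1 => [|j /negPf -> //]; congr (_ * _).
  rewrite -Wmx_sqr (@det_recurrence _ _ (fun i => expsum 1 (y i) 2 ^+ 2) (fun i => expsum 1 (y i) 2) (fun=> 1)) //.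
  - by rewrite big1 ?mul1r.
  - by move=> i; rewrite /f mul1r.
  move=> [|[|[|j]]].
  - exists (- 2), 0, 0%N, 0%N; split=> // i.
    by rewrite /f /expsum; field; rewrite y0.
  - exists (- 3), 0, 1%N, 0%N; split=> // i.
    by rewrite /f /expsum; field; rewrite y0.
  (* The second coefficient is -2 instead of -1 because column 0 has been halved. *)
  - exists (- 2), (- 2), 2%N, 0%N; split=> // i.
    by rewrite /f /expsum; field; rewrite y0.
  exists (- 2), (- 1), j.+3, j.+1; split=> [||i]; [lia|lia|].
  rewrite /f; have -> : (2 * j.+4.+1 = 2 * j.+1 + 4 + 4)%N by lia.
  rewrite expsum_rec // (_ : (2 * j.+1 + 4 = 2 * j.+3)%N); last by lia.
  by rewrite /expsum; field; rewrite y0 ?expf_neq0.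
move=> j; exists (fun=> 0) => i; rewrite !mxE big1 ?addr0 => [|l _]; last by rewrite mul0r.
rewrite /f -val_eqE /=; case: (nat_of_ord j) => [|k] /=; last by rewrite mul1r.
by rewrite /expsum !expr0 invr1 !mulr1.
Qed.

(** Two columns further, the exponent of z grows by 3, hence v = z^3 + z^(-3). In the first two
    steps v f_0 and v f_1 produce the exponents -2 and -1, which are -f_1 and -f_0 by oddness. *)
Lemma det_expsum_Sp N (y : 'I_N -> F) : (forall i, y i != 0) ->
  \det (\matrix_(i, j) expsum (-1) (y i) (2 * (1 + j + j./2))) =
  (\prod_i expsum (-1) (y i) 2) *
  \det (Wmx (fun i => expsum 1 (y i) 6) (fun i => expsum 1 (y i) 2)).
Proof.
move=> y0; rewrite -(@det_recurrence _ _ _ _ _ (fun j i => expsum (-1) (y i) (2 * (1 + j + j./2)))) //.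
  by move=> i; rewrite /expsum; field; rewrite y0.
move=> [|[|j]].
- exists 1, 0, 1%N, 0%N; split=> // i.
  by rewrite /expsum; field; rewrite y0.
- exists 1, 0, 0%N, 0%N; split=> // i.
  by rewrite /expsum; field; rewrite y0.
exists (- 1), 0, j, j; split=> [||i]; [lia|lia|].
have -> : (2 * (1 + j.+4 + j.+4./2) = 2 * (1 + j + j./2) + 6 + 6)%N by lia.
rewrite expsum_rec // mul0r addr0 (_ : (2 * (1 + j + j./2) + 6 = 2 * (1 + j.+2 + j.+2./2))%N) //; lia.
Qed.

(** The same recurrence with even columns. The polynomial u^2 - u - 1 is the quotient of z^(5/2) +
    z^(-5/2) by z^(1/2) + z^(-1/2), that is f_1 / f_0. *)
Lemma det_expsum_tO N (y : 'I_N -> F) : (forall i, y i != 0) ->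
  \det (\matrix_(i, j) expsum 1 (y i) (1 + 2 * j + 2 * uphalf j)) =
  (\prod_i expsum 1 (y i) 1) *
  \det (Wmx (fun i => expsum 1 (y i) 6)
            (fun i => expsum 1 (y i) 2 ^+ 2 - expsum 1 (y i) 2 - 1)).
Proof.
move=> y0; rewrite -(@det_recurrence _ _ _ _ _ (fun j i => expsum 1 (y i) (1 + 2 * j + 2 * uphalf j))) //.
  by move=> i; rewrite /expsum; field; rewrite y0.
move=> [|[|j]].
- exists (- 1), 0, 1%N, 0%N; split=> // i.
  by rewrite /expsum; field; rewrite y0.
- exists (- 1), 0, 0%N, 0%N; split=> // i.
  by rewrite /expsum; field; rewrite y0.
exists (- 1), 0, j, j; split=> [||i]; [lia|lia|].
have -> : (1 + 2 * j.+4 + 2 * uphalf j.+4 = 1 + 2 * j + 2 * uphalf j + 6 + 6)%N by lia.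
rewrite expsum_rec // mul0r addr0.
by rewrite (_ : (1 + 2 * j + 2 * uphalf j + 6 = 1 + 2 * j.+2 + 2 * uphalf j.+2)%N) //; lia.
Qed.

Lemma Sp_char_delta n (y : 'I_(2 * n.+1) -> F) :
  (forall i, y i != 0) -> (forall i, expsum (-1) (y i) 2 != 0) ->
  Sp_char (take (2 * n.+1) (delta2 (n.+1%:R - 1) (n.+1%:R - 1))) y =
  \det (Wmx (fun i => expsum 1 (y i) 6) (fun i => expsum 1 (y i) 2)) /
  \det (Vmx (fun i => expsum 1 (y i) 2)).
Proof.
move=> y0 d0; rewrite /Sp_char.
pose f (i j : 'I_(2 * n.+1)) := expsum (-1) (y i) (2 * (1 + j + j./2)).
pose g (i j : 'I_(2 * n.+1)) := expsum (-1) (y i) (2 * j.+1).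
rewrite [X in \det X / _](_ : _ = \matrix_(i, j) f i (rev_ord j)); last first.
  apply/matrixP=> i j; rewrite !mxE nth_take // nth_delta2_pred; last by rewrite -mul2n.
  have e := Sp_exponent (rev_ordK_nat j).
  by rewrite (halfpow_nat _ e) (halfpow_natN _ e) /f /expsum mulN1r.
rewrite [X in _ / \det X](_ : _ = \matrix_(i, j) g i (rev_ord j)); last first.
  apply/matrixP=> i j; rewrite !mxE.
  have e : 2 * ((rev_ord j)%:R + 1) = (2 * (rev_ord j).+1)%:R :> rat.
    by rewrite natr1 natrM.
  by rewrite (halfpow_nat _ e) (halfpow_natN _ e) /g /expsum mulN1r.
rewrite !det_rev_col signed_divff det_expsum_Sp // det_expsum2 //.
by rewrite -mulf_div divff ?mul1r //; apply/prodf_neq0.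
Qed.

Lemma tO_char_delta n (y : 'I_(2 * n.+1) -> F) :
  2 != 0 :> F -> (forall i, y i != 0) ->
  tO_char (take (2 * n.+1) (delta2 (n.+1%:R + 1 / 2) (n.+1%:R - 1 / 2))) y =
  (\prod_i expsum 1 (y i) 1) *
  \det (Wmx (fun i => expsum 1 (y i) 6)
            (fun i => expsum 1 (y i) 2 ^+ 2 - expsum 1 (y i) 2 - 1)) /
  \det (Vmx (fun i => expsum 1 (y i) 2)).
Proof.
move=> nz2 y0; rewrite /tO_char.
pose f (i j : 'I_(2 * n.+1)) := expsum 1 (y i) (1 + 2 * j + 2 * uphalf j).
pose g (i j : 'I_(2 * n.+1)) := expsum 1 (y i) (2 * j).
rewrite [X in \det X / _](_ : _ = \matrix_(i, j) f i (rev_ord j)); last first.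
  apply/matrixP=> i j; rewrite !mxE nth_take // nth_delta2_half; last by rewrite -mul2n ltnS ltnW.
  have e := tO_exponent (rev_ordK_nat j).
  by rewrite (halfpow_nat _ e) (halfpow_natN _ e) /f /expsum mul1r.
rewrite [X in _ / (_ * \det X)](_ : _ = \matrix_(i, j) g i (rev_ord j)); last first.
  apply/matrixP=> i j; rewrite !mxE.
  have e : 2 * (rev_ord j)%:R = (2 * rev_ord j)%:R :> rat by rewrite natrM.
  by rewrite (halfpow_nat _ e) (halfpow_natN _ e) /g /expsum mul1r.
rewrite !det_rev_col mulrCA signed_divff det_expsum_tO // det_expsum2_even //.
by rewrite mulKf.
Qed.
End Characters.

(** * Evaluation at fourth and sixth roots of unity *)

Section Evaluation.
Variable F : fieldType.

Lemma prod_ord_even_odd n (h : 'I_(2 * n) -> F) :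
  \prod_k h k = \prod_(i < n) (h (ord_even i) * h (ord_odd i)).
Proof.
pose p (ib : 'I_n * bool) := if ib.2 then ord_odd ib.1 else ord_even ib.1.
have pE ib : p ib = (2 * ib.1 + ib.2)%N :> nat by case: ib => i [] /=; rewrite ?addn1 ?addn0.
have bijp : bijective p.
  apply: inj_card_bij => [[i b] [j c] /(congr1 val) /=|].
    rewrite !pE /= => e; have [eij ->] : i = j :> nat /\ b = c.
      by case: b c e => [] []; lia.
    by congr (_, _); apply: ord_inj.
  by rewrite card_prod card_bool !card_ord mulnC.
rewrite (reindex p (onW_bij _ bijp)) -(pair_bigA _ (fun i b => h (p (i, b)))) /=.
by apply: eq_bigr => i _; rewrite big_bool mulrC.
Qed.

(** Every term of the Pfaffian uses n pairs and each index once, so the factors come out as k^n and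
    the product of the d_i. *)
Lemma Pf_Okada n (M : 'M[F]_(2 * n)) (k : F) (d v a b : 'I_(2 * n) -> F) :
  (2 ^ n * n`!)%N%:R != 0 :> F -> injective v ->
  (forall i j, i != j ->
     M i j = k * (d i * d j) * ((a j - a i) * (b j - b i) / (v j - v i))) ->
  Pf M = k ^+ n * (\prod_i d i) *
         (\det (Wmx v a) * \det (Wmx v b) / \det (Vmx v)).
Proof.
move=> nz injv ME; rewrite /Pf.
have -> : \sum_(s : 'S_(2 * n))
     (-1) ^+ s * \prod_(i < n) M (s (ord_even i)) (s (ord_odd i)) =
   k ^+ n * (\prod_i d i) * \sum_(s : 'S_(2 * n)) (-1) ^+ s *
     \prod_(i < n) ((a (s (ord_odd i)) - a (s (ord_even i))) *
                    (b (s (ord_odd i)) - b (s (ord_even i)))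
                    / (v (s (ord_odd i)) - v (s (ord_even i)))).
  rewrite mulr_sumr; apply: eq_bigr => s _; rewrite mulrCA; congr (_ * _).
  rewrite (reindex_inj (@perm_inj _ s)) prod_ord_even_odd.
  have -> : k ^+ n = \prod_(i < n) k by rewrite prodr_const card_ord.
  rewrite -!big_split /=; apply: eq_bigr => i _; apply: ME.
  by rewrite (inj_eq perm_inj) -val_eqE /= ltn_eqF.
rewrite (sum_pairing_Wratio (mul2n n) a b injv) => [|i|i]; rewrite /= ?mul2n //.
by rewrite mulrCA mulKf.
Qed.


(** Here 1/a = -a, so the difference becomes a sum. *)
Lemma sigma_i (a t : F) : a ^+ 2 = -1 -> t != 0 -> sigma (a * t) = a * (t + t^-1).
Proof.
move=> ea t0; have a0 : a != 0.
  by apply: contra_eqN ea => /eqP ->; rewrite expr0n eq_sym oppr_eq0 oner_eq0.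
by rewrite /sigma; field: ea; rewrite t0 a0.
Qed.

Section Entries.
Variables a x y : F.
Hypotheses (x0 : x != 0) (y0 : y != 0).

Let u (t : F) := expsum 1 t 2.
Let v (t : F) := expsum 1 t 6.
Let d (t : F) := expsum (-1) t 2.

Definition M2UO_entry : F :=
  sigma (y / x) * sigma (x * y) *
     (  sigma (a * x) * sigma (a * y) / sigma (a * x * y)
      - sigma (a * x) * sigma (a / y) / sigma (a * x / y)
      - sigma (a / x) * sigma (a * y) / sigma (a * y / x)
      + sigma (a / x) * sigma (a / y) / sigma (a / (x * y))).

(** Up to the factor a, the four denominators take only the values xy + 1/(xy) and x/y + y/x, whose
    product is u_x + u_y. *)
Lemma M2UO_entry4 : a ^+ 2 = -1 -> x ^+ 2 + y ^+ 2 != 0 -> 1 + x ^+ 2 * y ^+ 2 != 0 ->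
  M2UO_entry = - sigma a * (d x * d y) * ((u y - u x) / (u y + u x)).
Proof.
move=> ea nz1 nz2.
have a0 : a != 0.
  by apply: contra_eqN ea => /eqP ->; rewrite expr0n eq_sym oppr_eq0 oner_eq0.
have -> : u y + u x = (x * y + (x * y)^-1) * (x / y + (x / y)^-1).
  by rewrite /u /expsum; field; rewrite x0 y0.
rewrite /M2UO_entry -!(mulrA a) !(sigma_i ea) ?mulf_neq0 ?invr_eq0 ?mulf_neq0 //.
have -> : sigma a = 2 * a by rewrite -[in LHS](mulr1 a) sigma_i ?oner_eq0 // invr1; ring.
rewrite /sigma /d /u /expsum; field.
by rewrite -!expr2 x0 y0 a0 nz1 exprMn addrC nz2 oner_eq0.
Qed.

Lemma sigma_prod4 : a ^+ 2 = -1 ->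
  sigma (a * x / y) * sigma (a * y / x) * sigma (a * x * y) * sigma (a / (x * y)) =
  (u y + u x) ^+ 2.
Proof.
move=> ea; rewrite -!(mulrA a) !(sigma_i ea) ?mulf_neq0 ?invr_eq0 ?mulf_neq0 //.
rewrite /u /expsum; by field: ea; rewrite x0 y0 oner_eq0.
Qed.

Hypothesis ea : a ^+ 2 = a - 1.

Let a0 : a != 0.
Proof.
by apply: contra_eqN ea => /eqP ->; rewrite expr0n sub0r eq_sym oppr_eq0 oner_eq0.
Qed.

(** As a^2 + a^(-2) = -1, sigma(at) sigma(a/t) = -(1 + t^2 + t^(-2)), the quotient of a difference
    of cubes by a difference; take t = xy and t = x/y. *)
Lemma sigma_prod6 : u y - u x != 0 ->
  sigma (a * x / y) * sigma (a * y / x) * sigma (a * x * y) * sigma (a / (x * y)) =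
  (v y - v x) / (u y - u x).
Proof.
move=> nz; apply: (canRL (mulfK nz)).
rewrite /sigma /u /v /expsum; by field: ea; rewrite x0 y0 a0 ?oner_eq0.
Qed.

(** The factor u_x + u_y - 1 is the divided difference of b = u^2 - u - 1. Clearing the four
    denominators leaves an identity modulo a^2 = a - 1. *)
Lemma M2UO_entry6 :
  sigma (a * x / y) * sigma (a * y / x) * sigma (a * x * y) * sigma (a / (x * y)) != 0 ->
  M2UO_entry = - sigma a * (d x * d y) * ((u y - u x) * (u x + u y - 1) /
    (sigma (a * x / y) * sigma (a * y / x) * sigma (a * x * y) * sigma (a / (x * y)))).
Proof.
rewrite !mulf_eq0 !negb_or => /andP[/andP[/andP[nz1 nz2] nz3] nz4].
rewrite /M2UO_entry.
have -> : sigma (a * x / y) = sigma (a * (x / y)) by rewrite mulrA.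
set A1 := sigma (a * x * y); set A2 := sigma (a * (x / y)).
set A3 := sigma (a * y / x); set A4 := sigma (a / (x * y)).
have -> : sigma (y / x) * sigma (x * y) = u y - u x.
  by rewrite /u /expsum /sigma; field; rewrite x0 y0.
suff e : sigma (a * x) * sigma (a * y) * A2 * A3 * A4
      - sigma (a * x) * sigma (a / y) * A1 * A3 * A4
      - sigma (a / x) * sigma (a * y) * A1 * A2 * A4
      + sigma (a / x) * sigma (a / y) * A1 * A2 * A3 =
      - sigma a * (d x * d y) * (u x + u y - 1).
  rewrite [RHS](_ : _ = (u y - u x) * (- sigma a * (d x * d y) * (u x + u y - 1))
                        / (A2 * A3 * A1 * A4)); last by ring.
  have nzA2 : A2 != 0 by move: nz1; rewrite -mulrA.
  by rewrite -e; field; rewrite nzA2 nz2 nz3 nz4.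
by rewrite /A1 /A2 /A3 /A4 /sigma /d /u /expsum; field: ea; rewrite x0 y0 a0.
Qed.
End Entries.

(** Each index lies in N - 1 pairs, as the smaller or as the larger element. *)
Lemma prod_pairs N (f : 'I_N -> F) :
  \prod_(i < N) \prod_(j < N | (i < j)%N) (f i * f j) = \prod_(i < N) f i ^+ N.-1.
Proof.
under eq_bigr => i _ do rewrite big_split /=.
rewrite big_split /= [X in _ * X](exchange_big_dep predT) //= -big_split /=.
apply: eq_bigr => i _; rewrite -[N in RHS](card_ord N) -(cardC1 i) -prodr_const.
rewrite [RHS](bigID (fun j : 'I_N => (i < j)%N)) /=; congr (_ * _); apply: eq_bigl => j.
  by rewrite !inE -val_eqE /=; case: ltngtP.
by rewrite !inE -val_eqE /=; case: ltngtP.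
Qed.

(** For i < j, sigma(x_j/x_i) sigma(x_i x_j) = u_j - u_i; the terms i = j of the second product give
    sigma(x_i^2). *)
Lemma FUO_denominator n (x : 'I_(2 * n) -> F) : (forall i, x i != 0) ->
  (\prod_(i < 2 * n) \prod_(j < 2 * n | (i < j)%N) sigma (x j / x i)) *
  (\prod_(i < 2 * n) \prod_(j < 2 * n | (i <= j)%N) sigma (x i * x j)) =
  \det (Vmx (fun i => expsum 1 (x i) 2)) * \prod_i expsum (-1) (x i) 2.
Proof.
move=> x0; rewrite det_Vmx -!big_split; apply: eq_bigr => i _ /=.
rewrite [X in _ * X = _](bigD1 i) //= mulrCA mulrC; congr (_ * _); last first.
  by rewrite /sigma /expsum mulN1r -expr2.
rewrite [X in _ * X](eq_bigl (fun j : 'I_(2 * n) => (i < j)%N)); last first.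
  by move=> j; rewrite -val_eqE /=; case: ltngtP.
rewrite -big_split; apply: eq_bigr => j _ /=.
by rewrite /sigma /expsum; field; rewrite !x0.
Qed.

(** Collects the powers of s = sigma(a): the prefactor of [A2VO] and the (-s)^n coming from the
    Pfaffian. The cases are c = 4 for zeta_4 and c = 3 for zeta_6. *)
Lemma sigma_power (s c : F) n : s ^+ 2 = - c -> c != 0 ->
  s ^ (- (4 * n ^ 2)%N%:Z + n%:Z) * (- s) ^+ n = c ^- (n * (2 * n - 1)).
Proof.
move=> es c0; have s0 : s != 0.
  by apply: contraNneq c0 => s0; rewrite -oppr_eq0 -es s0 expr0n.
have e1 : s ^+ (4 * n ^ 2) = c ^+ (2 * n ^ 2).
  by rewrite -[4%N]/(2 * 2)%N -mulnA exprM es exprM sqrrN -exprM.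
have e2 : s ^+ n * (- s) ^+ n = c ^+ n by rewrite -exprMn mulrN -expr2 es opprK.
have e3 : c ^+ (2 * n ^ 2) = c ^+ n * c ^+ (n * (2 * n - 1)).
  by rewrite -exprD; congr (c ^+ _); case: (n) => // m; rewrite -mulnn; nia.
rewrite expfzDr // -exprnN e1 -mulrA -exprnP e2 e3.
by rewrite invfM mulrAC mulVf ?mul1r // expf_neq0.
Qed.

Section Specializations.
Variables (n : nat) (x : 'I_(2 * n) -> F) (a : F).
Hypotheses (nz_fact : (2 ^ n * n`!)%N%:R != 0 :> F) (x0 : forall i, x i != 0).

Let u i := expsum 1 (x i) 2.
Let d i := expsum (-1) (x i) 2.

Hypotheses (d0 : forall i, d i != 0) (u_inj : injective u).

Let uB0 i j : i != j -> u j - u i != 0.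
Proof. by move=> neij; rewrite subr_eq0 (inj_eq u_inj) eq_sym. Qed.

(** Let V be the Vandermonde determinant of u, D the product of the d_i and H that of the u_j + u_i.
    Then F_UO = H^2 / (V D), and the Pfaffian is (-sigma(a))^n D V^2 / (V H). *)
Lemma A2VO_i : 4 != 0 :> F -> a ^+ 2 = -1 ->
  (forall i j, i != j -> x i ^+ 2 + x j ^+ 2 != 0) ->
  (forall i j, i != j -> 1 + x i ^+ 2 * x j ^+ 2 != 0) ->
  A2VO x a =
  4 ^- (n * (2 * n - 1)) *
  \prod_(i < 2 * n) \prod_(j < 2 * n | (i < j)%N) (u j + u i).
Proof.
move=> nz4 ea nz1 nz2.
have uDE i j : u j + u i =
    (x j ^+ 2 + x i ^+ 2) * (1 + x i ^+ 2 * x j ^+ 2) / (x i * x j) ^+ 2.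
  by rewrite /u /expsum; field; rewrite !x0.
have uD0 i j : i != j -> u j + u i != 0.
  move=> neij; rewrite uDE !mulf_neq0 ?invr_eq0 ?expf_neq0 ?mulf_neq0 ?nz2 //.
  by rewrite nz1 // eq_sym.
have inj_u2 : injective (fun i => u i ^+ 2).
  move=> i j /eqP; rewrite eqf_sqr => /orP[/eqP/u_inj // | /eqP e].
  by apply: contra_eq e => /uD0; rewrite addrC -addr_eq0.
have ME i j : i != j -> M2UO x a a i j =
    - sigma a * (d i * d j) * ((u j - u i) * (u j - u i) / (u j ^+ 2 - u i ^+ 2)).
  move=> neij; rewrite mxE -/(M2UO_entry a (x i) (x j)) M2UO_entry4 ?nz1 ?nz2 //.
  rewrite -/(u i) -/(u j) -/(d i) -/(d j) subr_sqr; congr (_ * _).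
  by rewrite -mulf_div divff ?mul1r ?uB0.
rewrite /A2VO (Pf_Okada nz_fact inj_u2 ME) !Wmx_sqr /FUO FUO_denominator //.
set H := \prod_(i < 2 * n) \prod_(j < 2 * n | (i < j)%N) (u j + u i).
set D := \prod_i d i.
have -> : \prod_(i < 2 * n) \prod_(j < 2 * n | (i < j)%N)
     (sigma (a * x i / x j) * sigma (a * x j / x i) *
      sigma (a * x i * x j) * sigma (a / (x i * x j))) = H ^+ 2.
  rewrite -prodrXl; apply: eq_bigr => i _; rewrite -prodrXl.
  by apply: eq_bigr => j _; rewrite sigma_prod4.
have VE : \det (Vmx (fun i => u i ^+ 2)) = \det (Vmx u) * H.
  rewrite !det_Vmx -big_split; apply: eq_bigr => i _; rewrite -big_split.
  by apply: eq_bigr => j _; rewrite subr_sqr.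
have V0 : \det (Vmx u) != 0 by apply: det_Vmx_neq0.
have D0 : D != 0 by apply/prodf_neq0.
have H0 : H != 0.
  apply/prodf_neq0 => i _; apply/prodf_neq0 => j ltij; apply: uD0.
  by rewrite -val_eqE ltn_eqF.
have a0 : a != 0.
  by apply: contra_eqN ea => /eqP ->; rewrite expr0n eq_sym oppr_eq0 oner_eq0.
rewrite VE -(@sigma_power (sigma a)) //; last by rewrite /sigma; field: ea.
rewrite -/u -/d -/D; field.
by rewrite V0 D0 H0.
Qed.

(** The numerator of F_UO is det V(v) / det V(u). Its det V(v) cancels the denominator in Okada's
    formula, and two factors det V(u) remain below. *)
Lemma A2VO_zeta6 : 3 != 0 :> F -> a ^+ 2 = a - 1 ->
  injective (fun i => expsum 1 (x i) 6) ->
  A2VO x a =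
  3 ^- (n * (2 * n - 1)) *
  (\det (Wmx (fun i => expsum 1 (x i) 6) u) / \det (Vmx u)) *
  (\det (Wmx (fun i => expsum 1 (x i) 6) (fun i => u i ^+ 2 - u i - 1)) / \det (Vmx u)).
Proof.
set v := fun i => expsum 1 (x i) 6; set b := fun i => u i ^+ 2 - u i - 1.
move=> nz3 ea v_inj.
have vB0 i j : i != j -> v j - v i != 0.
  by move=> neij; rewrite subr_eq0 (inj_eq v_inj) eq_sym.
have prodE i j : i != j -> sigma (a * x i / x j) * sigma (a * x j / x i) *
      sigma (a * x i * x j) * sigma (a / (x i * x j)) = (v j - v i) / (u j - u i).
  by move=> neij; rewrite sigma_prod6 // uB0.
have ME i j : i != j -> M2UO x a a i j =
    - sigma a * (d i * d j) * ((u j - u i) * (b j - b i) / (v j - v i)).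
  move=> neij; rewrite mxE -/(M2UO_entry a (x i) (x j)) M2UO_entry6 // prodE //.
    rewrite -/(u i) -/(u j) -/(d i) -/(d j) /b; move: (uB0 neij) (vB0 _ _ neij) => ? ?.
    by field; apply/andP.
  by rewrite mulf_neq0 ?invr_eq0 ?uB0 ?vB0.
rewrite /A2VO (Pf_Okada nz_fact v_inj ME) /FUO FUO_denominator //.
have -> : \prod_(i < 2 * n) \prod_(j < 2 * n | (i < j)%N)
     (sigma (a * x i / x j) * sigma (a * x j / x i) *
      sigma (a * x i * x j) * sigma (a / (x i * x j))) =
    \det (Vmx v) / \det (Vmx u).
  rewrite !det_Vmx -prodf_div; apply: eq_bigr => i _; rewrite -prodf_div.
  by apply: eq_bigr => j ltij; rewrite prodE // -val_eqE ltn_eqF.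
set D := \prod_i d i.
have D0 : D != 0 by apply/prodf_neq0.
have Vu0 : \det (Vmx u) != 0 by apply: det_Vmx_neq0.
have Vv0 : \det (Vmx v) != 0 by apply: det_Vmx_neq0.
have a0 : a != 0.
  by apply: contra_eqN ea => /eqP ->; rewrite expr0n sub0r eq_sym oppr_eq0 oner_eq0.
rewrite -(@sigma_power (sigma a)) //; last by rewrite /sigma; field: ea.
rewrite -/u -/d -/D; field.
by rewrite Vu0 Vv0 D0.
Qed.

End Specializations.
End Evaluation.

(** * Non-vanishing in the field of rational functions *)

Section ExpsumNeq0.
Variables (F : fieldType) (x y : F).
Hypotheses (x0 : x != 0) (y0 : y != 0).

Lemma expsum_neq m : x ^+ m != y ^+ m -> x ^+ m * y ^+ m != 1 ->
  expsum 1 x m != expsum 1 y m.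
Proof.
move=> nexy nexy1; rewrite -subr_eq0.
have -> : expsum 1 x m - expsum 1 y m =
    (x ^+ m - y ^+ m) * (x ^+ m * y ^+ m - 1) / (x ^+ m * y ^+ m).
  by rewrite /expsum; field; rewrite !expf_neq0.
by rewrite !mulf_neq0 ?invr_eq0 ?mulf_neq0 ?expf_neq0 // subr_eq0.
Qed.

(** Multiplication by x^m (x^(2m) - s) gives x^(4m) - s^2, which treats both signs at once. *)
Lemma expsum_neq0 m s : s ^+ 2 = 1 -> x ^+ (m * 4) != 1 -> expsum s x m != 0.
Proof.
move=> es; apply: contraNneq => e; rewrite -subr_eq0.
have <- : (x ^+ m * x ^+ m - s) * (x ^+ m * expsum s x m) = x ^+ (m * 4) - 1.
  by rewrite /expsum exprM -es; field; rewrite expf_neq0.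
by rewrite e !mulr0.
Qed.

End ExpsumNeq0.

(** * Rewriting the two evaluations in the form of the theorem *)

Section ClosedForms.
Variables (F : fieldType) (n : nat) (x : 'I_(2 * n.+1) -> F).
Hypothesis x0 : forall i, x i != 0.

(** Each u_j + u_i is (x_i x_j)^(-2) (x_j^2 + x_i^2)(1 + x_i^2 x_j^2), and [prod_pairs] collects the
    monomials. *)
Lemma A2VO_i_closed_form :
  4 ^- (n.+1 * (2 * n.+1 - 1)) *
  \prod_(i < 2 * n.+1) \prod_(j < 2 * n.+1 | (i < j)%N)
     (expsum 1 (x j) 2 + expsum 1 (x i) 2) =
  2 ^ (- (4 * n.+1 ^ 2)%N%:Z + (2 * n.+1)%N%:Z) *
    (\prod_(i < 2 * n.+1) x i ^ (- (4 * n.+1)%N%:Z + 2)) *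
    (\prod_(i < 2 * n.+1) \prod_(j < 2 * n.+1 | (i < j)%N)
       ((x j ^+ 2 + x i ^+ 2) * (1 + x i ^+ 2 * x j ^+ 2))).
Proof.
rewrite -mulrA; congr (_ * _).
  have -> : - (4 * n.+1 ^ 2)%N%:Z + (2 * n.+1)%N%:Z = - (2 * (n.+1 * (2 * n.+1 - 1)))%N%:Z.
    by rewrite -mulnn; lia.
  by rewrite -exprnN [in RHS]exprM expr2 -natrM.
transitivity (\prod_(i < 2 * n.+1) \prod_(j < 2 * n.+1 | (i < j)%N)
   ((x i ^- 2 * x j ^- 2) * ((x j ^+ 2 + x i ^+ 2) * (1 + x i ^+ 2 * x j ^+ 2)))).
  apply: eq_bigr => i _; apply: eq_bigr => j _.
  by rewrite /expsum; field; rewrite !x0.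
under eq_bigr => i _ do rewrite big_split /=.
rewrite big_split /= (prod_pairs (fun i => x i ^- 2)); congr (_ * _).
apply: eq_bigr => i _.
have -> : - (4 * n.+1)%N%:Z + 2 = - (2 * (2 * n.+1).-1)%N%:Z by lia.
by rewrite -exprnN exprM exprVn.
Qed.

(** The product of the x_i + 1/x_i in the denominator cancels the factor left by [tO_char_delta]. *)
Lemma A2VO_zeta6_closed_form : 2 != 0 :> F ->
  (forall i, expsum (-1) (x i) 2 != 0) -> (forall i, expsum 1 (x i) 1 != 0) ->
  3 ^- (n.+1 * (2 * n.+1 - 1)) *
  (\det (Wmx (fun i => expsum 1 (x i) 6) (fun i => expsum 1 (x i) 2))
     / \det (Vmx (fun i => expsum 1 (x i) 2))) *
  (\det (Wmx (fun i => expsum 1 (x i) 6)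
            (fun i => expsum 1 (x i) 2 ^+ 2 - expsum 1 (x i) 2 - 1))
     / \det (Vmx (fun i => expsum 1 (x i) 2))) =
    3 ^ (- ((2 * n.+1 * (2 * n.+1 - 1)) %/ 2)%N%:Z) /
      (\prod_(i < 2 * n.+1) (x i + (x i)^-1)) *
    Sp_char (take (2 * n.+1) (delta2 (n.+1%:R - 1) (n.+1%:R - 1))) x *
    tO_char (take (2 * n.+1) (delta2 (n.+1%:R + 1 / 2) (n.+1%:R - 1 / 2))) x.
Proof.
move=> nz2 d0 t0; rewrite Sp_char_delta // tO_char_delta // -mulnA mulKn // -exprnN.
have -> : \prod_i (x i + (x i)^-1) = \prod_i expsum 1 (x i) 1.
  by apply: eq_bigr => i _; rewrite /expsum mul1r !expr1.
have T0 : \prod_i expsum 1 (x i) 1 != 0 by apply/prodf_neq0.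
set T := \prod_i _ in T0 *.
by rewrite -[T * _ / _]mulrA [RHS]mulrA [_ / T * _]mulrAC mulfVK.
Qed.

End ClosedForms.

(** * Non-vanishing of expressions in the indeterminates *)

Section RationalFunctions.
Variables (R : realType) (N : nat).
Local Notation x := (@indet R N).

Lemma tofrac_neq0_at (pt : 'I_N -> R[i]) (p : mpoly N R[i]) :
  meval pt p != 0 -> tofrac p != 0 :> ratfun R N.
Proof. by rewrite tofrac_eq0; apply: contraNneq => ->; rewrite meval0. Qed.

Lemma ratfun_natr_neq0 m : (0 < m)%N -> m%:R != 0 :> ratfun R N.
Proof.
move=> m0; rewrite -[1%R]/(1 : {fraction mpoly N R[i]}) -tofrac1 -tofracMn.
by apply: (@tofrac_neq0_at (fun=> 1)); rewrite mevalMn meval1 pnatr_eq0 -lt0n.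
Qed.

(** A test point: there x_i^m becomes 2^m, which is not 1 for m > 0, while the other indeterminates
    become 1. *)
Definition at2 (i k : 'I_N) : R[i] := if k == i then 2 else 1.

Lemma indet_neq0 i : x i != 0.
Proof.
by apply: (@tofrac_neq0_at (fun=> 1)); rewrite mevalXU oner_eq0.
Qed.

Lemma two_exp_neq1 m : (0 < m)%N -> (2 ^+ m : R[i]) != 1.
Proof. by move=> m0; rewrite -natrX (eqr_nat _ _ 1) gtn_eqF // (ltn_exp2l 0). Qed.

Lemma indetX_inj m i j : (0 < m)%N -> i != j -> x i ^+ m != x j ^+ m.
Proof.
move=> m0 neij; rewrite -subr_eq0 /indet -!tofracXn -tofracB.
apply: (@tofrac_neq0_at (at2 i)).
rewrite mevalB !rmorphXn /= !mevalXU /at2 eqxx [j == i]eq_sym (negPf neij).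
by rewrite expr1n subr_eq0 two_exp_neq1.
Qed.

Lemma indetXM_neq1 m i j : (0 < m)%N -> i != j -> x i ^+ m * x j ^+ m != 1.
Proof.
move=> m0 neij; rewrite -subr_eq0 /indet -!tofracXn -tofracM -tofrac1 -tofracB.
apply: (@tofrac_neq0_at (at2 i)).
rewrite mevalB mevalM !rmorphXn /= ?meval1 !mevalXU /at2 eqxx [j == i]eq_sym (negPf neij).
by rewrite expr1n mulr1 subr_eq0 two_exp_neq1.
Qed.

Lemma indetX_neq1 m i : (0 < m)%N -> x i ^+ m != 1.
Proof.
move=> m0; rewrite -subr_eq0 /indet -!tofracXn -tofrac1 -tofracB.
apply: (@tofrac_neq0_at (at2 i)).
by rewrite mevalB !rmorphXn /= ?meval1 !mevalXU /at2 eqxx subr_eq0 two_exp_neq1.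
Qed.

Lemma indet_sqrD_neq0 i j : x i ^+ 2 + x j ^+ 2 != 0.
Proof.
rewrite /indet -!tofracXn -tofracD; apply: (@tofrac_neq0_at (fun=> 1)).
by rewrite mevalD !rmorphXn /= !mevalXU !expr1n (pnatr_eq0 _ 2).
Qed.

Lemma indet_1DsqrM_neq0 i j : 1 + x i ^+ 2 * x j ^+ 2 != 0.
Proof.
rewrite /indet -!tofracXn -tofracM -tofrac1 -tofracD.
apply: (@tofrac_neq0_at (fun=> 1)).
by rewrite mevalD mevalM meval1 !rmorphXn /= !mevalXU !expr1n mulr1 (pnatr_eq0 _ 2).
Qed.

Lemma expsum_indet_inj m : (0 < m)%N -> injective (fun i => expsum 1 (x i) m).
Proof.
move=> m0 i j; apply: contra_eq => neij.
exact: (expsum_neq (indet_neq0 i) (indet_neq0 j)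
          (indetX_inj m0 neij) (indetXM_neq1 m0 neij)).
Qed.

End RationalFunctions.

(** * Equations of the fourth and sixth roots of unity *)

Section Zeta.
Variable R : realType.
Lemma zeta4_sqr : zeta R 4 ^+ 2 = -1.
Proof.
have -> : zeta R 4 = 'i%C.
  rewrite /zeta (_ : 2 * pi / 4%:R = pi / 2); last by field.
  by rewrite cos_pihalf sin_pihalf.
exact: sqr_i.
Qed.

(** From z^3 = -1 one has (z + 1)(z^2 - z + 1) = 0, and z + 1 is nonzero because the imaginary part
    sin(pi/3) is positive. *)
Lemma zeta6_sqr : zeta R 6 ^+ 2 = zeta R 6 - 1.
Proof.
rewrite /zeta (_ : 2 * pi / 6%:R = pi / 3); last by field.
set z := (_ +i* _)%C; suff e : z ^+ 3 = -1.
  have z1 : z + 1 != 0.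
    rewrite eq_complex /= negb_and orbC addr0 gt_eqF // sin_gt0_pi //.
    by rewrite divr_gt0 ?pi_gt0 //= ltr_pdivrMr // ltr_pMr ?pi_gt0 // ltr1n.
  apply/eqP; rewrite -subr_eq0.
  have : (z + 1) * (z ^+ 2 - (z - 1)) = 0 by ring: e.
  by move/eqP; rewrite mulf_eq0 (negPf z1).
have mulC (s t : R) : (cos s +i* sin s)%C * (cos t +i* sin t)%C
    = (cos (s + t) +i* sin (s + t))%C.
  by rewrite cosD sinD; apply/eqP; rewrite eq_complex /=; apply/andP; split; apply/eqP; ring.
rewrite exprS expr2 !mulC (_ : pi / 3 + (pi / 3 + pi / 3) = pi :> R); last by field.
by rewrite cospi sinpi; apply/eqP; rewrite eq_complex /= oppr0 !eqxx.
Qed.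
End Zeta.

Theorem theorem2p4 (R : realType) (n : nat) (hn : (1 <= n)%N) :
  let x : 'I_(2 * n) -> ratfun R (2 * n) := @indet R (2 * n) in
  A2VO x (ratfunC (2 * n) (zeta R 4)) =
    2 ^ (- (4 * n ^ 2)%N%:Z + (2 * n)%N%:Z) *
    (\prod_(i < 2 * n) x i ^ (- (4 * n)%N%:Z + 2)) *
    (\prod_(i < 2 * n) \prod_(j < 2 * n | (i < j)%N)
       ((x j ^+ 2 + x i ^+ 2) * (1 + x i ^+ 2 * x j ^+ 2)))
  /\
  A2VO x (ratfunC (2 * n) (zeta R 6)) =
    3 ^ (- ((2 * n * (2 * n - 1)) %/ 2)%N%:Z) /
      (\prod_(i < 2 * n) (x i + (x i)^-1)) *
    Sp_char (take (2 * n) (delta2 (n%:R - 1) (n%:R - 1))) x *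
    tO_char (take (2 * n) (delta2 (n%:R + 1 / 2) (n%:R - 1 / 2))) x.
Proof.
case: n hn => // n _ x.
have x0 i : x i != 0 by exact: indet_neq0.
have nat0 m : (0 < m)%N -> m%:R != 0 :> ratfun R (2 * n.+1) by exact: ratfun_natr_neq0.
have nz_fact : (2 ^ n.+1 * n.+1`!)%N%:R != 0 :> ratfun R (2 * n.+1).
  by apply: nat0; rewrite muln_gt0 expn_gt0 fact_gt0.
have sqrN1 : (-1) ^+ 2 = 1 :> ratfun R (2 * n.+1) by rewrite sqrrN expr1n.
have sqr1 : 1 ^+ 2 = 1 :> ratfun R (2 * n.+1) by rewrite expr1n.
have d0 i : expsum (-1) (x i) 2 != 0.
  exact: (@expsum_neq0 _ (x i) (x0 i) 2 _ sqrN1 (@indetX_neq1 R _ (2 * 4) i isT)).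
have t0 i : expsum 1 (x i) 1 != 0.
  exact: (@expsum_neq0 _ (x i) (x0 i) 1 _ sqr1 (@indetX_neq1 R _ (1 * 4) i isT)).
have u_inj := @expsum_indet_inj R (2 * n.+1) 2 isT.
have v_inj := @expsum_indet_inj R (2 * n.+1) 6 isT.
have ratfunC_sqr (c : R[i]) : ratfunC (2 * n.+1) c ^+ 2 = ratfunC (2 * n.+1) (c ^+ 2).
  by rewrite /ratfunC !expr2 mpolyCM tofracM.
split.
  rewrite (A2VO_i nz_fact x0 d0 u_inj (nat0 4 isT)).
  - exact: A2VO_i_closed_form.
  - by rewrite ratfunC_sqr zeta4_sqr /ratfunC mpolyCN mpolyC1 tofracN tofrac1.
  - by move=> i j _; exact: indet_sqrD_neq0.
  - by move=> i j _; exact: indet_1DsqrM_neq0.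
rewrite (A2VO_zeta6 nz_fact x0 d0 u_inj (nat0 3 isT)).
- exact: (A2VO_zeta6_closed_form x0 (nat0 2 isT) d0 t0).
- by rewrite ratfunC_sqr zeta6_sqr /ratfunC mpolyCB mpolyC1 tofracB tofrac1.
- exact: v_inj.
Qed.
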